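(* Let $A \in \mathbb{P}_{2n}(\mathbb{R})$ and let $D$ be the $n \times n$ diagonal matrix with diagonal entries $d_1(A),\ldots,d_n(A)$. Then $\Delta_c(A) \prec d_s(A)$ if and only if $A = N(D\oplus D)N^T$ for some $2n\times 2n$ orthosymplectic matrix $N$.
   Context: $\mathbb{P}_{2n}(\mathbb{R})$ is the set of $2n\times 2n$ real symmetric positive definite matrices. $J = \begin{pmatrix} 0 & I_n \\ -I_n & 0\end{pmatrix}$. $\operatorname{Sp}(2n)$ is the set of real $2n\times 2n$ matrices $M$ with $M^TJM=J$ (symplectic matrices); a real $2n\times 2n$ matrix is orthosymplectic if it is both orthogonal and symplectic. By Williamson's theorem, for $A\in\mathbb{P}_{2n}(\mathbb{R})$ there is $M\in\operatorname{Sp}(2n)$ such that $M^TAM = D\oplus D$ with $D$ an $n\times n$ diagonal matrix with positive diagonal entries $d_1(A)\le\cdots\le d_n(A)$; these numbers are uniquely determined by $A$ and are called the symplectic eigenvalues of $A$. Put $d_s(A) = (d_1(A),\ldots,d_n(A))\in\mathbb{R}^n$. Write $A = \begin{pmatrix} A_{11} & A_{12}\\ A_{12}^T & A_{22}\end{pmatrix}$ with $n\times n$ blocks; for an $n\times n$ matrix $X$ let $\Delta(X)\in\mathbb{R}^n$ be the vector of its diagonal entries, and define $\Delta_c(A) = \frac12\left[\Delta(A_{11})+\Delta(A_{22})\right]\in\mathbb{R}^n$. For $x\in\mathbb{R}^n$ let $x_1^\uparrow\le\cdots\le x_n^\uparrow$ be its entries in ascending order. For $x,y\in\mathbb{R}^n$,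 $x\prec y$ ($x$ is majorized by $y$) means $\sum_{i=1}^k x_i^\uparrow\ge\sum_{i=1}^k y_i^\uparrow$ for $k=1,\ldots,n$, with equality for $k=n$. *)

(* Defs.v *)
From mathcomp Require Export all_boot all_order all_algebra.
From mathcomp Require Export classical_sets reals.

Set Implicit Arguments.
Unset Strict Implicit.
Unset Printing Implicit Defensive.

Import Order.TTheory GRing.Theory Num.Theory.
Local Open Scope ring_scope.

Definition posdefmx (R : realType) (m : nat) (A : 'M[R]_m) : Prop :=
  A^T = A /\ forall x : 'cV[R]_m, x != 0 -> 0 < (x^T *m A *m x) 0 0.

Definition symplJ (R : realType) (n : nat) : 'M[R]_(n + n) :=
  block_mx 0 1%:M (- 1%:M) 0.

Definition symplecticmx (R : realType) (n : nat) (M : 'M[R]_(n + n)) : Prop :=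
  M^T *m symplJ R n *m M = symplJ R n.

Definition orthogonalmx (R : realType) (m : nat) (M : 'M[R]_m) : Prop :=
  M^T *m M = 1%:M.

Definition orthosymplecticmx (R : realType) (n : nat) (M : 'M[R]_(n + n)) :
    Prop :=
  orthogonalmx M /\ symplecticmx M.

Definition dsummx (R : realType) (n : nat) (X Y : 'M[R]_n) : 'M[R]_(n + n) :=
  block_mx X 0 0 Y.

Definition williamson_diag (R : realType) (n : nat) (A : 'M[R]_(n + n))
    (d : 'rV[R]_n) : Prop :=
  [/\ forall i, 0 < d 0 i,
      forall i j : 'I_n, (i <= j)%N -> d 0 i <= d 0 j &
      exists2 M : 'M[R]_(n + n), symplecticmx M &
        M^T *m A *m M = dsummx (diag_mx d) (diag_mx d)].

(* For positive definite A, Williamson's theorem says that exactly one d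
   satisfies williamson_diag A d, so xget returns that d; the default value 0
   is only taken for matrices A that have no such d. *)
Definition sympl_eigenvalues (R : realType) (n : nat) (A : 'M[R]_(n + n)) :
    'rV[R]_n :=
  xget 0 [set d | williamson_diag A d]%classic.

Definition diag_of (R : realType) (n : nat) (X : 'M[R]_n) : 'rV[R]_n :=
  \row_i X i i.

Definition Delta_c (R : realType) (n : nat) (A : 'M[R]_(n + n)) : 'rV[R]_n :=
  2^-1 *: (diag_of (ulsubmx A) + diag_of (drsubmx A)).

Definition ascending (R : realType) (n : nat) (x : 'rV[R]_n) : seq R :=
  sort <=%R [seq x 0 i | i : 'I_n].

Definition majorized (R : realType) (n : nat) (x y : 'rV[R]_n) : Prop :=
  (forall k : nat, (1 <= k <= n)%N ->
     \sum_(i < k) (ascending y)`_i <= \sum_(i < k) (ascending x)`_i) /\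
  \sum_(i < n) (ascending x)`_i = \sum_(i < n) (ascending y)`_i.

(* Main.v *)
(* Let M be the Williamson matrix of A, L = D (+) D and S = J M J^T = M^-T, so
   that A = S L S^T.  The equality case k = n of the majorization says
   tr A = tr L.  With T = J S J^T = S^-T and JL = LJ,
   tr ((S - T) L (S - T)^T) = tr A + tr L - 2 tr L = 0, and since L is positive
   this forces S = S^-T, i.e. S is orthogonal.
   Conversely, if A = N L N^T with N orthogonal, then Delta_c(A) = B d where
   B_ij, half the sum of the squares of the four entries of N lying over (i, j),
   is doubly stochastic. *)
Require Import Defs.
From mathcomp Require Import ring lra.

Set Implicit Arguments.
Unset Strict Implicit.
Unset Printing Implicit Defensive.

Import Order.TTheory GRing.Theory Num.Theory.
Local Open Scope ring_scope.

(** * Ascending rearrangements and majorization *)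

Lemma sum_nth_take (V : nmodType) (s : seq V) (k : nat) :
  (k <= size s)%N -> \sum_(i < k) s`_i = \sum_(v <- take k s) v.
Proof.
move=> le_k; rewrite (big_nth 0) size_takel // big_mkord.
by apply: eq_bigr => i _; rewrite nth_take.
Qed.

(** Sorting indices instead of values records which rows of a matrix produce the smallest
    entries. *)
Lemma ascendingE (R : realType) (n : nat) (x : 'rV[R]_n) :
  ascending x =
  [seq x 0 i | i <- sort (relpre (fun i => x 0 i) <=%R) (enum 'I_n)].
Proof. exact: sort_map. Qed.

Lemma size_ascending (R : realType) (n : nat) (x : 'rV[R]_n) :
  size (ascending x) = n.
Proof. by rewrite size_sort size_map size_enum_ord. Qed.

Lemma sum_ascending (R : realType) (n : nat) (x : 'rV[R]_n) :
  \sum_(i < n) (ascending x)`_i = \sum_i x 0 i.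
Proof.
rewrite sum_nth_take ?size_ascending // -{1}(size_ascending x) take_size.
rewrite (perm_big _ (permEl (perm_sort _ _))) big_map big_enum.
exact: eq_bigr.
Qed.

Lemma ascending_id (R : realType) (n : nat) (y : 'rV[R]_n) :
  (forall i j : 'I_n, (i <= j)%N -> y 0 i <= y 0 j) ->
  ascending y = [seq y 0 i | i <- enum 'I_n].
Proof.
move=> y_le; rewrite /ascending sorted_sort //; first exact: le_trans.
rewrite sorted_map; apply: (@sub_sorted _ (relpre val leq)) => [i j|].
  exact: y_le.
by have := iota_sorted 0 n; rewrite -val_enum_ord sorted_map.
Qed.

Lemma sum_nth_ord (R : realType) (n k : nat) (y : 'rV[R]_n) :
  (k <= n)%N ->
  \sum_(i < k) [seq y 0 i | i <- enum 'I_n]`_i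
    = \sum_(j < n) y 0 j * (j < k)%N%:R.
Proof.
move=> le_kn; rewrite (big_ord_widen _ (fun i => _`_i) le_kn) big_mkcond /=.
apply: eq_bigr => j _; case: ifP => _; last by rewrite mulr0.
by rewrite (nth_map j) ?size_enum_ord // nth_ord_enum mulr1.
Qed.

(** The [k] smallest entries of the averaged vector add up to a combination of the entries of [y]
    with weights in [0, 1] of total mass [k]. Such a combination is least when the mass sits on the
    [k] smallest entries of [y]. *)
Lemma doubly_stochastic_majorized (R : realType) (n : nat) (B : 'M[R]_n)
    (y : 'rV[R]_n) :
  (forall i j, 0 <= B i j) -> (forall i, \sum_j B i j = 1) ->
  (forall j, \sum_i B i j = 1) ->
  (forall i j : 'I_n, (i <= j)%N -> y 0 i <= y 0 j) ->
  majorized (y *m B^T) y.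
Proof.
move=> B_ge0 B_row B_col y_le; split; last first.
  rewrite !sum_ascending; under eq_bigr do rewrite mxE.
  rewrite exchange_big; apply: eq_bigr => j _ /=.
  by under eq_bigr do rewrite mxE; rewrite -mulr_sumr B_col mulr1.
(* From here on there are [k.+1] summands, so [k] itself is a valid index: that of the last entry of
   [y] summed. *)
case=> // k /andP[_ lt_kn].
rewrite (ascending_id y_le) (sum_nth_ord _ lt_kn).
rewrite sum_nth_take ?size_ascending // ascendingE -map_take big_map.
set s := sort _ _.
have size_s : size s = n by rewrite size_sort size_enum_ord.
pose c j := \sum_(i <- take k.+1 s) B i j.
have -> : \sum_(i <- take k.+1 s) (y *m B^T) 0 i = \sum_j y 0 j * c j.
  under eq_bigr do rewrite mxE.
  rewrite exchange_big; apply: eq_bigr => j _ /=.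
  by rewrite mulr_sumr; apply: eq_bigr => i _; rewrite mxE.
have c_ge0 j : 0 <= c j by exact: sumr_ge0.
have c_le1 j : c j <= 1.
  have <- : \sum_(i <- s) B i j = 1.
    by rewrite (perm_big _ (permEl (perm_sort _ _))) big_enum.
  rewrite -(cat_take_drop k.+1 s) big_cat /= lerDl; exact: sumr_ge0.
have sum_c : \sum_j c j = k.+1%:R.
  rewrite exchange_big /=; under eq_bigr do rewrite B_row.
  by rewrite big_const_seq count_predT size_takel ?size_s // iter_addr_0.
have sum_ind : \sum_(j < n) (j < k.+1)%N%:R = k.+1%:R :> R.
  transitivity (\sum_(j < n | (j < k.+1)%N) (1 : R)).
    by rewrite [RHS]big_mkcond; apply: eq_bigr => j _; case: (j < k.+1)%N.
  rewrite -(big_ord_widen _ (fun=> 1) lt_kn).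
  by rewrite sumr_const card_ord.
(* Both weights have total mass k+1, so y may be shifted by the threshold
   y_k, after which every summand of the difference is nonnegative. *)
pose t := y 0 (Ordinal lt_kn).
rewrite -subr_ge0 -sumrB.
have -> : \sum_j (y 0 j * c j - y 0 j * (j < k.+1)%N%:R)
    = \sum_j (y 0 j - t) * (c j - (j < k.+1)%N%:R).
  apply/eqP; rewrite -subr_eq0 -sumrB.
  rewrite (eq_bigr (fun j : 'I_n => t * (c j - (j < k.+1)%N%:R))) => [|j _].
    by rewrite -mulr_sumr sumrB sum_c sum_ind subrr mulr0.
  ring.
apply: sumr_ge0 => j _; case: ltnP => [lt_jk|le_kj].
  by apply: mulr_le0; rewrite subr_le0 ?c_le1 // y_le.
by rewrite subr0 mulr_ge0 // subr_ge0 y_le // ltnW.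
Qed.

(** * Diagonals and traces of congruences of diagonal matrices *)

Lemma dsummx_diag (R : realType) (n : nat) (d : 'rV[R]_n) :
  dsummx (diag_mx d) (diag_mx d) = diag_mx (row_mx d d).
Proof. by rewrite diag_mx_row. Qed.

Lemma mx_diag_trE (R : realType) (m p : nat) (T : 'M[R]_(m, p)) (d : 'rV[R]_p)
    (i : 'I_m) :
  (T *m diag_mx d *m T^T) i i = \sum_j T i j ^+ 2 * d 0 j.
Proof.
rewrite mxE; apply: eq_bigr => j _; rewrite mul_mx_diag !mxE; ring.
Qed.

Lemma Delta_cE (R : realType) (n : nat) (A : 'M[R]_(n + n)) (i : 'I_n) :
  Delta_c A 0 i =
  2^-1 * (A (lshift n i) (lshift n i) + A (rshift n i) (rshift n i)).
Proof. by rewrite !mxE. Qed.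

Lemma mxtrace_Delta_c (R : realType) (n : nat) (A : 'M[R]_(n + n)) :
  \tr A = 2 * \sum_i Delta_c A 0 i.
Proof.
rewrite /mxtrace big_split_ord /= -big_split mulr_sumr.
by apply: eq_bigr => i _; rewrite Delta_cE /=; field.
Qed.

Lemma Delta_c_orthogonal (R : realType) (n : nat) (N : 'M[R]_(n + n))
    (d : 'rV[R]_n) :
  (forall i j : 'I_n, (i <= j)%N -> d 0 i <= d 0 j) ->
  orthogonalmx N ->
  majorized (Delta_c (N *m dsummx (diag_mx d) (diag_mx d) *m N^T)) d.
Proof.
move=> d_le NTN; have NNT : N *m N^T = 1%:M by exact: mulmx1C.
have row1 a : \sum_b N a b ^+ 2 = 1.
  have /matrixP/(_ a a) := NNT; rewrite !mxE eqxx mulr1n => <-.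
  by apply: eq_bigr => b _; rewrite mxE expr2.
have col1 b : \sum_a N a b ^+ 2 = 1.
  have /matrixP/(_ b b) := NTN; rewrite !mxE eqxx mulr1n => <-.
  by apply: eq_bigr => a _; rewrite mxE expr2.
pose l := @lshift n n; pose r := @rshift n n.
pose B := \matrix_(i, j) (2^-1 *
  (N (l i) (l j) ^+ 2 + N (l i) (r j) ^+ 2 +
   (N (r i) (l j) ^+ 2 + N (r i) (r j) ^+ 2))).
have -> : Delta_c (N *m dsummx (diag_mx d) (diag_mx d) *m N^T) = d *m B^T.
  rewrite dsummx_diag; apply/rowP => i; rewrite Delta_cE !mx_diag_trE.
  rewrite !big_split_ord [RHS]mxE /=.
  rewrite -!big_split mulr_sumr; apply: eq_bigr => j _ /=.
  rewrite !row_mxEl !row_mxEr !mxE /l /r; ring.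
apply: doubly_stochastic_majorized => // [i j|i|j].
- by rewrite mxE mulr_ge0 ?invr_ge0 // !addr_ge0 ?sqr_ge0.
(* Row [i] of [B] averages the squared entries of the unit rows [l i] and [r i] of [N]; columns
   behave likewise. *)
- under eq_bigr do rewrite mxE.
  rewrite -mulr_sumr !big_split /=.
  have := row1 (l i); have := row1 (r i); rewrite !big_split_ord /= /l /r.
  lra.
- under eq_bigr do rewrite mxE.
  rewrite -mulr_sumr !big_split /=.
  have := col1 (l j); have := col1 (r j); rewrite !big_split_ord /= /l /r.
  lra.
Qed.

(** * Symplectic matrices and rigidity of the trace *)

Lemma symplJ_tr (R : realType) (n : nat) : (symplJ R n)^T = - symplJ R n.
Proof.
by rewrite /symplJ tr_block_mx opp_block_mx !raddf0 opprK raddfN /= trmx1.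
Qed.

Lemma symplJ_mulT (R : realType) (n : nat) :
  symplJ R n *m (symplJ R n)^T = 1%:M.
Proof.
rewrite symplJ_tr /symplJ opp_block_mx mulmx_block !raddf0 opprK.
by rewrite !(mul0mx, mulmx0, mul1mx, mulmx1, mulNmx, add0r, addr0, oppr0, opprK)
  -scalar_mx_block.
Qed.

Lemma symplJ_comm_dsummx (R : realType) (n : nat) (X : 'M[R]_n) :
  symplJ R n *m dsummx X X = dsummx X X *m symplJ R n.
Proof.
rewrite /symplJ /dsummx !mulmx_block.
by rewrite !(mul0mx, mulmx0, mul1mx, mulmx1, mulNmx, mulmxN, add0r, addr0).
Qed.

(** This exhibits the inverse of [M^T] explicitly, as a conjugate of [M] by J. *)
Lemma symplecticmx_dualV (R : realType) (n : nat) (M : 'M[R]_(n + n)) :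
  symplecticmx M -> M^T *m (symplJ R n *m M *m (symplJ R n)^T) = 1%:M.
Proof. by move=> M_sp; rewrite !mulmxA M_sp symplJ_mulT. Qed.

Lemma symplecticmx_dual (R : realType) (n : nat) (M : 'M[R]_(n + n)) :
  symplecticmx M -> symplecticmx (symplJ R n *m M *m (symplJ R n)^T).
Proof.
rewrite /symplecticmx => M_sp; have JJT := symplJ_mulT R n.
rewrite !trmx_mul trmxK !mulmxA -[_ *m _^T *m symplJ R n]mulmxA.
rewrite (mulmx1C JJT) mulmx1 -!mulmxA (mulmxA M^T) (mulmxA (M^T *m _)) M_sp.
by rewrite JJT mulmx1.
Qed.

(** The trace is a sum of nonnegative terms [T i j ^+ 2 * d 0 j], so each of them vanishes. *)
Lemma mx_diag_tr_eq0 (R : realType) (m p : nat) (T : 'M[R]_(m, p))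
    (d : 'rV[R]_p) :
  (forall j, 0 < d 0 j) -> \tr (T *m diag_mx d *m T^T) = 0 -> T = 0.
Proof.
move=> d_gt0 trT0; apply/matrixP => i j; rewrite mxE.
have term_ge0 a b : 0 <= T a b ^+ 2 * d 0 b.
  by rewrite mulr_ge0 ?sqr_ge0 ?ltW.
have diag0 : \sum_b T i b ^+ 2 * d 0 b = 0.
  move: trT0; rewrite /mxtrace; under eq_bigr do rewrite mx_diag_trE.
  by move/psumr_eq0P => -> // a _; exact: sumr_ge0.
have /psumr_eq0P/(_ diag0 j isT)/eqP :
    forall b, true -> 0 <= T i b ^+ 2 * d 0 b by [].
by rewrite mulf_eq0 (gt_eqF (d_gt0 j)) orbF sqrf_eq0 => /eqP.
Qed.

Lemma symplectic_trace_min_orthogonal (R : realType) (n : nat)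
    (S : 'M[R]_(n + n)) (d : 'rV[R]_n) (D := diag_mx d) :
  symplecticmx S -> (forall i, 0 < d 0 i) ->
  \tr (S *m dsummx D D *m S^T) = \tr (dsummx D D) -> orthogonalmx S.
Proof.
rewrite /symplecticmx /orthogonalmx => S_sp d_gt0.
set J := symplJ R n in S_sp *; set L := dsummx D D => trE.
have JJT : J *m J^T = 1%:M by exact: symplJ_mulT.
have JTJ : J^T *m J = 1%:M by exact: mulmx1C.
have JL : J *m L = L *m J by exact: symplJ_comm_dsummx.
have JLJT : J^T *m L *m J = L by rewrite -mulmxA -JL mulmxA JTJ mul1mx.
pose T := J *m S *m J^T.
have STT : S^T *m T = 1%:M by exact: symplecticmx_dualV.
have TTS : T^T *m S = 1%:M by rewrite -[S]trmxK -trmx_mul STT trmx1.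
(* By cyclicity the outer factors [J] cancel, and the inner ones fix [L], leaving the trace of
   [S *m L *m S^T]. *)
have trT : \tr (T *m L *m T^T) = \tr L.
  rewrite -trE /T !trmx_mul trmxK !mulmxA.
  rewrite mxtrace_mulC !mulmxA JTJ mul1mx.
  by rewrite -!mulmxA (mulmxA J^T) (mulmxA (J^T *m L)) JLJT.
have T_eq : S - T = 0.
  apply: (@mx_diag_tr_eq0 _ _ _ _ (row_mx d d)) => [j|].
    by case: (split_ordP j) => i ->; rewrite ?row_mxEl ?row_mxEr.
  (* Each cross term has trace [\tr L] by cyclicity, since [T^T *m S] and [S^T *m T] are the
     identity; the four traces cancel. *)
  rewrite -dsummx_diag -/D -/L linearB /= !(mulmxBl, mulmxBr) !raddfB /=.
  rewrite trT trE [\tr (S *m L *m T^T)]mxtrace_mulC mulmxA TTS mul1mx.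
  rewrite [\tr (T *m L *m S^T)]mxtrace_mulC mulmxA STT mul1mx; ring.
by move/subr0_eq: T_eq => {2}->.
Qed.

(** * Positive definite matrices and the equivalence *)

Lemma posdefmx_diag_gt0 (R : realType) (m : nat) (A : 'M[R]_m) (i : 'I_m) :
  posdefmx A -> 0 < A i i.
Proof.
case=> _ /(_ (delta_mx i 0)); rewrite trmx_delta -rowE -colE !mxE; apply.
apply/eqP => /matrixP/(_ i 0)/eqP; by rewrite !mxE !eqxx oner_eq0.
Qed.

Theorem theorem4 (R : realType) (n : nat) (A : 'M[R]_(n + n))
    (hA : posdefmx A) :
  let D := diag_mx (sympl_eigenvalues A) in
  majorized (Delta_c A) (sympl_eigenvalues A) <->
  exists2 N : 'M[R]_(n + n), orthosymplecticmx N & A = N *m dsummx D D *m N^T.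
Proof.
rewrite /sympl_eigenvalues; case: xgetP => [d _ [d_gt0 d_le [M M_sp ME]]|_] /=.
  split=> [[_] |[N [N_orth _] ->]]; last exact: Delta_c_orthogonal.
  rewrite !sum_ascending => sumE.
  set S := symplJ R n *m M *m (symplJ R n)^T.
  have MTS : M^T *m S = 1%:M by exact: symplecticmx_dualV.
  have SMT : S *m M^T = 1%:M by exact: mulmx1C.
  have MST : M *m S^T = 1%:M by rewrite -[M]trmxK -trmx_mul SMT trmx1.
  have AE : A = S *m dsummx (diag_mx d) (diag_mx d) *m S^T.
    by rewrite -ME !mulmxA SMT mul1mx -mulmxA MST mulmx1.
  have S_sp : symplecticmx S by exact: symplecticmx_dual.
  exists S => //; split=> //.
  apply: (symplectic_trace_min_orthogonal S_sp d_gt0); rewrite -AE.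
  (* Both traces are twice an entry sum, of [Delta_c A] and of [d] respectively. *)
  by rewrite (mxtrace_Delta_c A) sumE mxtrace_block !mxtrace_diag mulr_natl
    mulr2n.
(* If A had no Williamson diagonal, xget would return 0; both sides then force
   tr A = 0, so Williamson's existence theorem is not required. *)
case: n A hA => [|n] A hA.
  (* An empty matrix has trace 0, so no contradiction arises here; both sides hold instead. *)
  have empty_eq (X Y : 'M[R]_(0 + 0)) : X = Y by apply/matrixP; case.
  split=> [_|_]; first by exists 1%:M => //; split; exact: empty_eq.
  by split=> [[]|] //; rewrite !big_ord0.
have trA : 0 < \tr A.
  rewrite /mxtrace (bigD1 (lshift n.+1 ord0)) //=.
  rewrite ltr_pwDl ?posdefmx_diag_gt0 //; apply: sumr_ge0 => i _.
  by rewrite ltW ?posdefmx_diag_gt0.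
split=> [[_]|[N _ AE]].
  rewrite !sum_ascending => sumE; move: trA; rewrite mxtrace_Delta_c sumE.
  by under eq_bigr do rewrite mxE; rewrite sumr_const mul0rn mulr0 ltxx.
by move: trA; rewrite AE dsummx_diag row_mx0 raddf0 mulmx0 mul0mx mxtrace0 ltxx.
Qed.
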